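(* Let $p$ be an odd prime and let $G$ be a group of order $p^4$ which is not $p$-central. Then the transiso graph $\Gamma_p(G)$ is not complete.
   Context: A finite $p$-group is not $p$-central if it has a subgroup of order $p$ not contained in its center. For a finite group $G$ and a subgroup $H\le G$, a normalized right transversal (NRT) of $H$ in $G$ is a subset $S\subseteq G$ with $1\in S$ containing exactly one element of each right coset of $H$ in $G$; $\mathcal{T}(G,H)$ denotes the set of all NRTs of $H$ in $G$. An NRT $S$ carries the induced binary operation $\circ$ defined by $\{x\circ y\}=S\cap Hxy$ for $x,y\in S$, which makes $S$ a right loop with identity $1$. Two NRTs $S,T$ (possibly of different subgroups) are isomorphic, $S\cong T$, if there is a bijection $S\to T$ preserving the induced operations. For a divisor $d$ of $|G|$, the transiso graph $\Gamma_d(G)$ is the simple graph whose vertices are the subgroups of $G$ of order $d$, and in which two distinct vertices $H_1,H_2$ are adjacent if and only if there exist $S_i\in\mathcal{T}(G,H_i)$ $(i=1,2)$ with $S_1\cong S_2$. A graph is complete if any two distinct vertices are adjacent. *)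

(* Defs.v *)
From mathcomp Require Import all_boot all_fingroup all_solvable.

Set Implicit Arguments.
Unset Strict Implicit.
Unset Printing Implicit Defensive.

Import GroupScope.

Section TransisoGraph.

Variable gT : finGroupType.
Implicit Types (G H K : {group gT}) (S T : {set gT}).

Definition p_central (p : nat) G : bool :=
  [forall H : {group gT},
     (H \subset G) && (#|H| == p) ==> (H \subset 'Z(G))].

(* The set T(G, H), for H a subgroup of G. *)
Definition NRTs G H : {set {set gT}} :=
  [set S : {set gT} | is_transversal S (rcosets H G) G && (1 \in S)].

(* When S is in T(G, H) and x, y are in S, the intersection below is a
   singleton and repr returns its unique element. *)
Definition nrt_op H S (x y : gT) : gT := repr (S :&: (H :* (x * y))).

Definition nrt_isog H S K T : Prop :=
  exists f : gT -> gT,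
    [/\ {in S &, injective f}, f @: S = T
      & {in S &, forall x y, f (nrt_op H S x y) = nrt_op K T (f x) (f y)}].

Definition transiso_vertices (d : nat) G : {set {group gT}} :=
  [set H in subgroups G | #|H| == d].

Definition transiso_adj G H K : Prop :=
  H != K /\
  exists S T, [/\ S \in NRTs G H, T \in NRTs G K & nrt_isog H S K T].

Definition transiso_complete (d : nat) G : Prop :=
  {in transiso_vertices d G &, forall H K, H != K -> transiso_adj G H K}.

End TransisoGraph.

(* Main.v *)
(* Let H and K be adjacent vertices with K normal. An NRT of K is a copy
   of G / K. If H is normal too, then G / H and G / K are isomorphic.
   Otherwise H has trivial core, and an NRT of H on which the induced
   operation is associative is a subgroup: H has a complement isomorphic
   to G / K, and this complement is maximal, hence contains G'.

   A normal elementary abelian subgroup E of order p^2 contains G', since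
   G / E is abelian. Suppose that the graph is complete. If Z(G) is
   cyclic, E contains a noncentral H of order p. As a complement of H
   contains G', we get G' <> E, so G' is central of order p, and the p-th
   powers of a complement M of H are too numerous for M to be isomorphic
   to G / G'. If Z(G) is not cyclic, choose E central. When G' = E, a
   complement of a noncentral subgroup of order p is abelian, because E is
   central of index p in it; but G / K is not abelian for K < E of order
   p. When G' < E, the quotients of G by G' and by another subgroup of
   order p of E are not isomorphic, as only the first one is abelian. *)
Require Import Defs.
From mathcomp Require Import all_boot all_fingroup all_solvable.

Set Implicit Arguments.
Unset Strict Implicit.
Unset Printing Implicit Defensive.

Import GroupScope.

(** * Induced operations on transversals and the quotients they determine *)

Section Transversals.

Variable gT : finGroupType.
Implicit Types (G H K L M : {group gT}) (S T : {set gT}).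

Lemma NRTs_sub G H S : S \in NRTs G H -> S \subset G.
Proof. by rewrite inE => /andP[/transversal_sub]. Qed.

Lemma NRTs1 G H S : S \in NRTs G H -> 1 \in S.
Proof. by rewrite inE => /andP[]. Qed.

(** [nrt_op H S x y] is this map at [x * y]. *)
Definition nrt_repr H S (g : gT) : gT := repr (S :&: H :* g).

Lemma nrt_repr_def G H S g :
  S \in NRTs G H -> g \in G -> S :&: H :* g = [set nrt_repr H S g].
Proof.
rewrite inE => /andP[/and3P[_ _ /forall_inP trS] _] Gg.
have /trS/cards1P[y defy] : H :* g \in rcosets H G.
  by apply/rcosetsP; exists g.
by rewrite /nrt_repr defy repr_set1.
Qed.

Lemma mem_nrt_repr G H S g :
  S \in NRTs G H -> g \in G -> nrt_repr H S g \in S.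
Proof.
move=> trS Gg; have /setP/(_ (nrt_repr H S g)) := nrt_repr_def trS Gg.
by rewrite set11 => /setIP[].
Qed.

Lemma nrt_repr_rcoset G H S g :
  S \in NRTs G H -> g \in G -> nrt_repr H S g \in H :* g.
Proof.
move=> trS Gg; have /setP/(_ (nrt_repr H S g)) := nrt_repr_def trS Gg.
by rewrite set11 => /setIP[].
Qed.

Lemma nrt_repr_unique G H S g s :
  S \in NRTs G H -> g \in G -> s \in S -> s \in H :* g -> nrt_repr H S g = s.
Proof.
move=> trS Gg Ss Hgs; have /setP/(_ s) := nrt_repr_def trS Gg.
by rewrite in_setI Ss Hgs in_set1 => /esym/eqP.
Qed.

(* Transporting associativity from [G / K] to [S], [z * x * y] and
   [z * (x o y)] have the same right coset for every [z], so that
   [x * y] and [x o y] agree modulo the core of [H]. Hence [core * S] is a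
   subgroup [M], on which [S -> T -> G / K] is a morphism. *)
Lemma nrt_isog_quotient G H K S T :
    H \subset G -> K <| G -> S \in NRTs G H -> T \in NRTs G K ->
    nrt_isog H S K T ->
  exists M : {group gT},
    [/\ M \subset G, H * M = G, H :&: M = gcore H G
      & M / gcore H G \isog G / K].
Proof.
move=> sHG nsKG trS trT [f [injf defT morf]].
have [sKG nKG] := andP nsKG.
have sSG := subsetP (NRTs_sub trS); have sTG := subsetP (NRTs_sub trT).
have S1 := NRTs1 trS; have T1 := NRTs1 trT.
pose L := gcore H G; pose rho := nrt_repr H S.
have sLH : L \subset H := gcore_sub H G.
have nLG : G \subset 'N(L) := gcore_norm H G.
have sLG := subset_trans sLH sHG.
have fT x : x \in S -> f x \in T by move=> Sx; rewrite -defT imset_f.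
have fG x : x \in S -> f x \in G by move/fT/sTG.
have rhoS g : g \in G -> rho g \in S by apply: mem_nrt_repr.
have rhoH g : g \in G -> rho g \in H :* g by apply: nrt_repr_rcoset.
have rhoP g s : g \in G -> s \in S -> s \in H :* g -> rho g = s.
  exact: nrt_repr_unique.
have rhoid s : s \in S -> rho s = s.
  by move=> Ss; apply: rhoP; rewrite ?sSG ?rcoset_refl.
have opE x y : nrt_op H S x y = rho (x * y) by [].
pose phi g := coset K (f (rho g)).
have nKf x : x \in S -> f x \in 'N(K) by move/fG/(subsetP nKG).
have phiS s : s \in S -> phi s = coset K (f s) by move=> Ss; rewrite /phi rhoid.
(* An element of [G] and its representative in [T] lie in the same coset of [K], so the operation of
   [T] becomes the product of [G / K]. *)
have phi_op x y : x \in S -> y \in S ->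
  coset K (f (rho (x * y))) = coset K (f x) * coset K (f y).
  move=> Sx Sy; rewrite -opE morf // -morphM ?nKf //=.
  apply/esym/rcoset_kercosetP; rewrite ?groupM ?nKf //.
    by rewrite (subsetP nKG) // (sTG _ (mem_nrt_repr trT _)) ?groupM ?fG.
  by rewrite rcoset_sym; apply: (nrt_repr_rcoset trT); rewrite groupM ?fG.
have injphi x y : x \in S -> y \in S ->
  coset K (f x) = coset K (f y) -> x = y.
  move=> Sx Sy /rcoset_kercosetP; rewrite !nKf // => /(_ isT isT) Kxy.
  apply: injf => //; rewrite -(nrt_repr_unique trT (fG y Sy) (fT x Sx)) //.
  by rewrite (nrt_repr_unique trT (fG y Sy) (fT y Sy)) ?rcoset_refl.
have opL x y : x \in S -> y \in S -> x * y \in L :* rho (x * y).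
  move=> Sx Sy; have [Gx Gy] := (sSG x Sx, sSG y Sy).
  have Gxy := groupM Gx Gy; have Sxy := rhoS _ Gxy; have Gr := sSG _ Sxy.
  have assoc z : z \in S -> rho (rho (z * x) * y) = rho (z * rho (x * y)).
    move=> Sz; have Gz := sSG z Sz; have Szx := rhoS _ (groupM Gz Gx).
    apply: injphi; rewrite ?rhoS ?groupM ?(sSG _ Szx) //.
    by rewrite !phi_op // mulgA.
  (* The core is the intersection of the conjugates of [H]. As [g] lies in [H :* rho g], it is
     enough to conjugate by [z = rho g], an element of [S], to which [assoc] applies. *)
  rewrite mem_rcoset; apply/bigcapP=> g Gg; rewrite mem_conjg conjgE invgK.
  have Sz := rhoS g Gg; have := rhoH g Gg; move: (rho g) Sz => z Sz.
  rewrite rcoset_sym => /rcosetP[h Hh ->].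
  have Gz := sSG z Sz; have Gzx := groupM Gz Gx; have Szx := rhoS _ Gzx.
  rewrite invMg -!mulgA groupMl // !mulgA groupMr ?groupV //.
  suff : z * x * y \in H :* (z * rho (x * y)).
    by rewrite mem_rcoset invMg !mulgA.
  have Hzx : z * x \in H :* rho (z * x) by rewrite rcoset_sym rhoH.
  apply: (@rcoset_trans _ _ _ (rho (z * x) * y)).
    by rewrite mem_rcoset invMg mulgA mulgK -mem_rcoset.
  have Gzxy := groupM (sSG _ Szx) Gy.
  apply: (@rcoset_trans _ _ _ (rho (rho (z * x) * y))).
    by rewrite rcoset_sym rhoH.
  by rewrite assoc // rhoH ?groupM.
have rhoL l s : l \in L -> s \in S -> rho (l * s) = s.
  move=> Ll Ss; apply: rhoP => //.
    by rewrite groupM ?(subsetP sLG l) ?sSG.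
  by rewrite mem_rcoset invMg mulKVg groupV (subsetP sLH).
have mulLS x y : x \in L * S -> y \in L * S ->
  (x * y \in L * S) /\ (phi (x * y) = phi x * phi y).
  case/mulsgP=> l1 s Ll1 Ss ->; case/mulsgP=> l2 t Ll2 St ->.
  have /rcosetP[l Ll defst] := opL s t Ss St.
  have Sst := rhoS _ (groupM (sSG s Ss) (sSG t St)).
  have -> : l1 * s * (l2 * t) = (l1 * l2 ^ s^-1 * l) * rho (s * t).
    by rewrite -[RHS]mulgA -defst conjgE invgK !mulgA mulgKV.
  have L3 : l1 * l2 ^ s^-1 * l \in L.
    by rewrite groupM ?(groupM Ll1) ?memJ_norm ?groupV ?(subsetP nLG) ?sSG.
  split; first exact: mem_mulg.
  by rewrite /phi (rhoL _ _ L3) ?(rhoL l1) ?(rhoL l2) ?phi_op.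
have gM : group_set (L * S).
  apply/group_setP; split=> [|x y LSx LSy]; last by case: (mulLS x y).
  by rewrite -[1]mulg1 mem_mulg.
pose M := Group gM; have phiM : {in M &, {morph phi : x y / x * y}}.
  by move=> x y Mx My; case: (mulLS x y).
pose phim := Morphism phiM.
have sLM : L \subset M by apply: mulg_subl.
have sMG : M \subset G by rewrite mul_subG ?(NRTs_sub trS).
have rho1 m : m \in M -> rho m = 1 -> m \in L.
  by case/mulsgP=> l s Ll Ss ->; rewrite rhoL // => ->; rewrite mulg1.
have phi1 : phi 1 = 1 by apply: (morph1 phim).
exists M; split=> //.
- apply/eqP; rewrite eqEsubset mul_subG //=; apply/subsetP=> g Gg.
  have := rhoH g Gg; rewrite rcoset_sym => /rcosetP[h Hh ->].
  by rewrite mem_mulg // -[rho g]mul1g mem_mulg ?rhoS.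
(* An element of [H] has representative [1] in [S]. *)
- apply/eqP; rewrite eqEsubset subsetI sLH sLM !andbT.
  apply/subsetP=> m /setIP[Hm Mm]; apply: rho1 => //.
  by apply: rhoP; rewrite ?(subsetP sMG) // mem_rcoset mul1g groupV.
have <- : 'ker phim = gcore H G.
  apply/setP=> m; apply/idP/idP=> [/setIP[Mm] | Lm].
    rewrite !inE /= => /eqP phim1; apply: rho1 => //.
    have Gm := subsetP sMG m Mm; apply: injphi; rewrite ?rhoS //.
    by rewrite -/(phi m) phim1 -phi1 phiS.
  rewrite !inE (subsetP sLM) //=; apply/eqP; rewrite -[m]mulg1.
  by rewrite /phi rhoL // -phiS // phi1.
(* Surjectivity: [f] maps [S] onto [T], which meets every coset of [K]. *)
have <- : phim @* M = G / K; last exact: first_isog.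
apply/setP=> u; apply/idP/idP=> [/morphimP[m _ Mm ->]|].
  by rewrite /= mem_quotient // fG // rhoS // (subsetP sMG).
case/morphimP=> g Ng Gg ->; have := mem_nrt_repr trT Gg.
rewrite -defT => /imsetP[s Ss deft]; have Ms : s \in M.
  by rewrite -[s]mul1g mem_mulg.
apply/morphimP; exists s; rewrite //= phiS //.
apply/rcoset_kercosetP; rewrite ?nKf // -deft rcoset_sym.
by rewrite defT (nrt_repr_rcoset trT).
Qed.

(** A normal [H] is its own core, so [M] contains [H] and [H * M = G] gives [M = G]. *)
Lemma transiso_adj_normal G H K :
  H <| G -> K <| G -> transiso_adj G H K -> G / H \isog G / K.
Proof.
move=> nsHG nsKG [_ [S [T [trS trT isoST]]]]; have [sHG nHG] := andP nsHG.
have [M [_ defG tiHM]] := nrt_isog_quotient sHG nsKG trS trT isoST.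
have coreH : gcore H G = H.
  by apply/eqP; rewrite eqEsubset gcore_sub gcore_max.
rewrite coreH in tiHM *; have sHM : H \subset M by apply/setIidPl.
by rewrite -defG mulSGid.
Qed.

(** By primality the core of [H] is [1] or [H], and the latter would make [H] normal; a trivial core
    makes [M] a complement. *)
Lemma transiso_adj_compl G H K :
    prime #|H| -> H \subset G -> ~~ (H <| G) -> K <| G ->
    transiso_adj G H K ->
  exists M : {group gT}, M \in [complements to H in G] /\ M \isog G / K.
Proof.
move=> prH sHG nnHG nsKG [_ [S [T [trS trT isoST]]]].
have [M [sMG defG tiHM]] := nrt_isog_quotient sHG nsKG trS trT isoST.
have core1 : gcore H G = 1.
  apply/eqP; apply: contraR nnHG => ntL; rewrite /normal sHG.
  have sHL : H \subset gcore H G.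
    by apply: prime_meetG; rewrite //= (setIidPr (gcore_sub H G)).
  have -> : H :=: gcore H G by apply/eqP; rewrite eqEsubset sHL gcore_sub.
  exact: gcore_norm.
rewrite core1 in tiHM *; move=> isoM; exists M; split; first exact/complP.
by apply: isog_trans isoM; apply: quotient1_isog.
Qed.

End Transversals.

(** * Powers, normal subgroups and complements in p-groups *)

Lemma Mho1_abelem (gT : finGroupType) (p : nat) (G : {group gT}) :
  p.-abelem G -> 'Mho^1(G) = 1.
Proof.
move=> abelG; have [pG cGG _] := and3P abelG.
rewrite (MhoEabelian 1 pG cGG); apply/setP=> x; rewrite inE.
apply/imsetP/eqP=> [[y Gy ->] | ->]; last by exists 1; rewrite ?expg1n.
by rewrite expn1 (exponentP _ _ Gy) //; case/and3P: abelG.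
Qed.

Section PGroups.

Variables (gT : finGroupType) (p : nat).
Implicit Types E G H K M : {group gT}.

Lemma prime_normal_center G K :
  nilpotent G -> K <| G -> prime #|K| -> K \subset 'Z(G).
Proof.
move=> nilG nsKG prK; rewrite prime_meetG ?meet_center_nil //.
by rewrite -cardG_gt1 prime_gt1.
Qed.

(** Odd order excludes the extremal 2-groups, so some normal abelian [X] is not cyclic. Then
    ['Ohm_1(X)] has rank at least 2 and contains a subgroup of order p^2 normal in [G]. *)
Lemma normal_pnElem2_odd G :
    p.-group G -> odd #|G| -> ~~ cyclic G ->
  exists2 E : {group gT}, E \in 'E_p^2(G) & E <| G.
Proof.
move=> pG oddG ncG.
have [X /and3P[nsXG cXX ncX]|noX] :=
  pickP (fun X : {group gT} => [&& X <| G, abelian X & ~~ cyclic X]); last first.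
  case: (normal_rank1_structure pG) => [X nsXG cXX||].
  - by have := noX X; rewrite nsXG cXX => /negbFE.
  - by rewrite (negPf ncG).
  by rewrite (negPf (odd_not_extremal2 oddG)) andbF.
have pX := pgroupS (normal_sub nsXG) pG.
have abelO := Ohm1_abelem pX cXX.
have nsOG : 'Ohm_1(X) <| G by rewrite gFnormal_trans.
have [|E [sEO nsEG oE]] := @normal_pgroup p _ 2 _ _ pG nsOG.
  rewrite -p_rank_abelem // p_rank_Ohm1 -rank_pgroup // ltnNge.
  by rewrite -abelian_rank1_cyclic.
exists E; rewrite // pnElemE ?inE; last first.
  case: (pgroup_pdiv pX) => //; apply: contra ncX => /eqP->; exact: cyclic1.
by rewrite (normal_sub nsEG) (abelemS sEO) // oE eqxx.
Qed.

Lemma card_proper_p2group E H :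
    prime p -> #|E| = (p ^ 2)%N -> H \subset E -> H :!=: 1 ->
  ~~ (E \subset H) -> #|H| = p.
Proof.
move=> p_pr oE sHE ntH; have := cardSg sHE; rewrite oE.
case/(dvdn_pfactor _ _ p_pr)=> -[|[|[|//]]] _ oH.
- by case/negP: ntH; rewrite trivg_card1 oH.
- by rewrite oH expn1.
have /eqP-> : H :==: E by rewrite eqEcard sHE oE oH /=.
by rewrite subxx.
Qed.

Lemma maximal_compl G H M :
    prime p -> p.-group G -> #|H| = p -> M \in [complements to H in G] ->
  maximal M G.
Proof.
move=> p_pr pG oH /complP[tiHM defG].
have sMG : M \subset G by rewrite -defG mulG_subr.
apply: p_index_maximal => //.
by rewrite -divgS // -defG TI_cardMg // oH mulnK // prime_gt0.
Qed.

Lemma der1_sub_maximal G M : p.-group G -> maximal M G -> G^`(1) \subset M.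
Proof.
move=> pG maxM; apply: subset_trans (Phi_sub_max maxM).
by rewrite (Phi_joing pG) joing_subl.
Qed.

(* [K] consists of p-th powers of [M], because [M] meets the cyclic center in
   more than [p] elements. All p-th powers of [G / K = (H / K) (M / K)] come from
   [M / K], so that there are strictly fewer of them than in [M]. *)
Lemma compl_not_isog_quotient G H K M :
    prime p -> p.-group G -> cyclic 'Z(G) -> #|H| = p -> #|K| = p ->
    #|M| = (p ^ 3)%N -> K \subset 'Z(G) -> G^`(1) \subset K ->
  M \in [complements to H in G] -> ~~ (M \isog G / K).
Proof.
move=> p_pr pG cycZ oH oK oM sKZ sG'K complM; apply/negP=> isoM.
have [tiHM defG] := complP complM.
have [sHG sMG] : H \subset G /\ M \subset G.
  by rewrite -defG mulG_subl mulG_subr.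
have cGKGK : abelian (G / K) := sub_der1_abelian sG'K.
have cMM : abelian M by rewrite (isog_abelian isoM).
have pM := pgroupS sMG pG.
have ntK : K :!=: 1 by rewrite -cardG_gt1 oK prime_gt1.
have /cyclicP[x defH] : cyclic H by rewrite prime_cyclic ?oH.
have Gx : x \in G by rewrite -cycle_subG -defH.
pose C := 'C_M[x].
(* [C] centralizes [H = <[x]>] and the abelian [M], hence [G = H * M]. *)
have sCZ : C \subset 'Z(G).
  rewrite subsetI (subset_trans (subsetIl _ _)) //= -defG centM subsetI.
  rewrite defH cent_cycle subsetIr /=.
  exact: subset_trans (subsetIl _ _) cMM.
(* The index counts the [M]-conjugates of [x], which lie in [x *: K] because [K] contains [G']. *)
have leCp : #|M : C| <= p.
  rewrite index_cent1 -oK -(card_lcoset K x) subset_leq_card //.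
  apply/subsetP=> _ /imsetP[y My ->]; rewrite mem_lcoset.
  by rewrite (subsetP sG'K) // -commgEl mem_commg // (subsetP sMG).
have pC : p.-group C := pgroupS (subsetIl _ _) pM.
have cycC : cyclic C := cyclicS sCZ cycZ.
have ltpC : p < #|C|.
  rewrite ltnNge; apply/negP=> leC; have := leq_mul leC leCp.
  by rewrite Lagrange ?subsetIl // oM leqNgt (ltn_exp2l 2 3) ?prime_gt1.
(* Otherwise [C] would equal ['Ohm_1(C)], of order p. *)
have ntMho : 'Mho^1(C) != 1.
  apply/eqP=> Mho1; have /eqP := trivg_Mho (introT eqP Mho1).
  have ntC : C != 1 by rewrite -cardG_gt1 (leq_trans (prime_gt1 p_pr)) // ltnW.
  have := Ohm1_cyclic_pgroup_prime cycC pC ntC.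
  by move=> oO eqO; rewrite -oO eqO ltnn in ltpC.
(* In the cyclic center, inclusion of subgroups amounts to divisibility of orders. *)
have sKMho : K \subset 'Mho^1(M).
  apply: subset_trans (MhoS 1 (subsetIl M 'C[x])).
  rewrite -(cardSg_cyclic cycZ) ?(subset_trans (Mho_sub 1 _)) // oK.
  by have [] := pgroup_pdiv (pgroupS (Mho_sub 1 _) pC) ntMho.
have nKG : G \subset 'N(K) by rewrite normal_norm ?sub_center_normal.
have defGK : (H / K) \* (M / K) = G / K.
  rewrite cprodE; first by rewrite -quotientMl ?(subset_trans sHG) // defG.
  by rewrite (sub_abelian_cent2 cGKGK) ?quotientS.
have := Mho_cprod 1 defGK.
rewrite (Mho1_abelem (quotient_abelem K (prime_abelem p_pr oH))) cprod1g.
rewrite -morphim_Mho ?(subset_trans sMG) // => defMho.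
have := ltn_quotient ntK sKMho; rewrite (card_isog (isog_Mho 1 isoM)).
by rewrite /= -defMho ltnn.
Qed.

End PGroups.

(** * Groups of order p^4, according to whether the center is cyclic *)

Theorem theorem3p11 (gT : finGroupType) (G : {group gT}) (p : nat)
  (p_prime : prime p) (p_odd : odd p)
  (cardG : #|G| = (p ^ 4)%N)
  (npcG : ~~ p_central p G) :
  ~ transiso_complete p G.
Proof.
move=> complete.
have pG : p.-group G by rewrite /pgroup cardG pnatX pnat_id.
have nilG := pgroup_nil pG.
have [A /andP[/andP[sAG /eqP oA] nZA]] :
  exists A : {group gT}, (A \subset G) && (#|A| == p) && ~~ (A \subset 'Z(G)).
  by have /forallPn[A] := npcG; rewrite negb_imply; exists A.
have not_cGG : ~~ abelian G.
  by apply: contra nZA => cGG; rewrite (center_idP cGG).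
have ntG' : G^`(1) != 1 by apply: contra not_cGG => /eqP/derG1P.
have vertex (H : {group gT}) :
    H \subset G -> #|H| = p -> H \in transiso_vertices p G.
  by move=> sHG oH; rewrite !inE sHG oH eqxx.
have quot_isog (K1 K2 : {group gT}) : K1 \subset 'Z(G) -> K2 \subset 'Z(G) ->
    #|K1| = p -> #|K2| = p -> G / K1 \isog G / K2.
  move=> sK1Z sK2Z oK1 oK2; have [-> | neqK] := eqVneq K1 K2.
    exact: isog_refl.
  apply: transiso_adj_normal; rewrite ?sub_center_normal //.
  by apply: complete; rewrite // vertex // (subset_trans _ (center_sub G)).
have compl_isog (H K : {group gT}) :
    H \subset G -> #|H| = p -> ~~ (H \subset 'Z(G)) ->
    K \subset 'Z(G) -> #|K| = p ->
  exists M : {group gT},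
    [/\ M \in [complements to H in G], maximal M G & M \isog G / K].
  move=> sHG oH nZH sKZ oK.
  have [||||M [complM isoM]] := @transiso_adj_compl gT G H K _ sHG.
  - by rewrite oH.
  (* A normal subgroup of order p is central. *)
  - by apply: contra nZH => nsHG; rewrite (prime_normal_center nilG) ?oH.
  - exact: sub_center_normal.
  - apply: complete; rewrite ?vertex // ?(subset_trans sKZ) ?center_sub //.
    by apply: contraNneq nZH => ->.
  by exists M; rewrite complM isoM (maximal_compl p_prime pG oH complM).
have oM (M : {group gT}) : maximal M G -> #|M| = (p ^ 3)%N.
  move=> maxM; have := Lagrange (proper_sub (maxgroupp maxM)).
  rewrite (p_maximal_index pG maxM) cardG expnSr => /eqP.
  by rewrite eqn_pmul2r ?prime_gt0 // => /eqP.
have der1_p2 (E : {group gT}) : E <| G -> #|E| = (p ^ 2)%N -> G^`(1) \subset E.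
  case/andP=> sEG nEG oE; apply: der1_min => //.
  apply: p2group_abelian (quotient_pgroup E pG) _.
  rewrite card_quotient // -divgS // cardG oE -expnB ?prime_gt0 //.
  by rewrite pfactorK.
have [cycZ | ncycZ] := boolP (cyclic 'Z(G)).
  have [||E EpE nsEG] := normal_pnElem2_odd pG.
  - by rewrite cardG oddX p_odd.
  - by apply: contra not_cGG; apply: cyclic_abelian.
  have [sEG abelE oE] := pnElemPcard EpE.
  have nZE : ~~ (E \subset 'Z(G)).
    apply: contraL (leqnn 2) => sEZ.
    have := abelem_cyclic abelE; rewrite (cyclicS sEZ) // oE pfactorK //.
  have sG'E := der1_p2 E nsEG oE.
  have [x Ex nZx] := subsetPn nZE.
  have ntx : x != 1 by apply: contraNneq nZx => ->; apply: group1.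
  have ox : #|<[x]>| = p := abelem_order_p abelE Ex ntx.
  have sxG : <[x]> \subset G by rewrite cycle_subG (subsetP sEG).
  have nZ_x : ~~ (<[x]> \subset 'Z(G)) by rewrite cycle_subG.
  have oG' : #|G^`(1)| = p.
    (* Any central [<[y]>] of order p yields a complement [M] of [<[x]>]. If [E] were inside [G'],
       then [x] would lie in [<[x]> :&: M = 1]. *)
    have [y Zy oy] : {y | y \in 'Z(G) & #[y] = p}.
      apply: Cauchy => //.
      have [|_ pZ _] // := pgroup_pdiv (pgroupS (center_sub G) pG).
      rewrite center_nil_eq1 //.
      by apply: contraNneq not_cGG => ->; apply: abelian1.
    have [|M [/complP[tixM _] maxM _]] := compl_isog _ <[y]>%G sxG ox nZ_x _ oy.
      by rewrite cycle_subG.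
    apply: card_proper_p2group oE sG'E ntG' _ => //.
    apply: contra ntx => sEG'.
    rewrite -cycle_eq1 -subG1 -tixM subsetI subxx cycle_subG.
    by rewrite (subsetP (der1_sub_maximal pG maxM)) // (subsetP sEG').
  have sG'Z : G^`(1) \subset 'Z(G).
    by rewrite (prime_normal_center nilG) ?der_normal ?oG'.
  (* Now [G'] itself can serve as the central subgroup of order p. *)
  have [M [complM maxM isoM]] := compl_isog _ _ sxG ox nZ_x sG'Z oG'.
  have /negP[] // := compl_not_isog_quotient
    p_prime pG cycZ ox oG' (oM M maxM) sG'Z (subxx _) complM.
have [E EpE] : exists E : {group gT}, E \in 'E_p^2('Z(G)).
  apply/p_rank_geP; rewrite -rank_pgroup ?(pgroupS (center_sub G)) //.
  by rewrite ltnNge -abelian_rank1_cyclic ?center_abelian.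
have [sEZ abelE oE] := pnElemPcard EpE.
have sG'E := der1_p2 E (sub_center_normal sEZ) oE.
have subE (K : {group gT}) :
    K \in 'E_p^1(E) -> [/\ K \subset E, K \subset 'Z(G) & #|K| = p].
  case/pnElemPcard=> sKE _; rewrite expn1 => oK.
  by split=> //; apply: subset_trans sEZ.
have der1_quot (K : {group gT}) :
    K \in 'E_p^1(E) -> abelian (G / K) = (G^`(1) \subset K).
  case/subE=> _ sKZ _; apply/idP/idP; last exact: sub_der1_abelian.
  by apply: der1_min; rewrite ?normal_norm ?sub_center_normal.
have card_p1E := card_p1Elem_p2Elem EpE.
have [sEG' | nsEG'] := boolP (E \subset G^`(1)).
  have [K EpK] : exists K : {group gT}, K \in 'E_p^1(E).
    by apply/card_gt0P; rewrite card_p1E.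
  have [_ sKZ oK] := subE K EpK.
  have [M [_ maxM isoM]] := compl_isog A K sAG oA nZA sKZ oK.
  have sMG := proper_sub (maxgroupp maxM).
  have sEM := subset_trans sEG' (der1_sub_maximal pG maxM).
  have cMM : abelian M.
    apply: (@cyclic_factor_abelian _ E).
      rewrite subsetI sEM (subset_trans sEZ) //.
      by rewrite (subset_trans (subsetIr _ _)) ?centS.
    rewrite prime_cyclic // card_quotient; last first.
      by rewrite cents_norm // centsC (subset_trans sEZ) // subIset ?centS ?orbT.
    by rewrite -divgS // oM // oE -expnB ?prime_gt0.
  have := der1_quot K EpK; rewrite -(isog_abelian isoM) cMM => /esym sG'K.
  have := subset_leq_card (subset_trans sEG' sG'K).
  by rewrite oE oK leqNgt (ltn_exp2l 1 2) ?prime_gt1.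
have oG' := card_proper_p2group p_prime oE sG'E ntG' nsEG'.
have EpG' : G^`(1)%G \in 'E_p^1(E).
  by rewrite pnElemE // !inE sG'E (abelemS sG'E) //= oG' expn1 eqxx.
(* [E] has p + 1 subgroups of order p, hence p besides [G']. *)
have [K /setD1P[neqK EpK]] : exists K : {group gT}, K \in 'E_p^1(E) :\ G^`(1)%G.
  apply/card_gt0P; have := cardsD1 G^`(1)%G 'E_p^1(E).
  by rewrite EpG' card_p1E add1n => -[<-]; apply: prime_gt0.
have [[_ sG'Z _] [_ sKZ oK]] := (subE _ EpG', subE K EpK).
have := isog_abelian (quot_isog _ _ sG'Z sKZ oG' oK).
rewrite !der1_quot // subxx => /esym sG'K.
by case/eqP: neqK; apply/val_inj/eqP; rewrite eq_sym eqEcard sG'K oG' oK /=.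
Qed.
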